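(* Let $\boldsymbol{Y} = (Y_0, Y_1, \ldots)$ be a downward run chain on the poset $(S, \preceq)$ with transition function $Q$, and define $G: S \to (0,1]$ by $G(x) = \mathbb{P}_e(U_x \le U_e)$. Then $G$ is left-invariant for $Q$, that is, $\sum_{x \in S} G(x) Q(x,y) = G(y)$ for every $y \in S$.
   Context: $(S, \preceq)$ is a discrete (countable) partially ordered set with a minimum element $e$, such that for every $x \in S$ every chain (totally ordered subset) in $S$ from $e$ to $x$ is finite. An element $y$ covers $x$ if $y$ is a minimal element of $\{t \in S : t \succ x\}$. For $x \in S$, $B_x = \{w \in S : x \text{ covers } w\}$. A downward run chain on $(S, \preceq)$ is a (time-homogeneous, discrete-time) Markov chain on $S$ whose transition function $Q$ satisfies $Q(x,y) > 0$ if and only if either $x = e$ and $y \in S$, or $x \in S - \{e\}$ and $y \in B_x$. $\mathbb{P}_e$ denotes probability given $Y_0 = e$, and $U_x = \min\{n \ge 1 : Y_n = x\}$ is the first positive hitting time of $x$ (with $\min\emptyset=\infty$). *)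

(* Defs.v *)
From HB Require Import structures.
From mathcomp Require Import all_boot all_order all_algebra.
From mathcomp Require Import all_classical all_reals all_analysis.

Set Implicit Arguments.
Unset Strict Implicit.
Unset Printing Implicit Defensive.

Import Order.TTheory GRing.Theory Num.Theory.

Local Open Scope classical_set_scope.
Local Open Scope ring_scope.

Section Poset.
Context {disp : Order.disp_t} {S : bPOrderType disp}.

(* The endpoints [\bot] and [x] belong to the chain. *)
Definition chain_from_bot (x : S) (C : set S) : Prop :=
  [/\ total_on C (fun a b => (a <= b)%O), C \bot%O, C x &
      forall a, C a -> (\bot <= a <= x)%O].

Definition finite_chains_from_bot : Prop :=
  forall (x : S) (C : set S), chain_from_bot x C -> finite_set C.

Definition minimal_element (A : set S) (y : S) : Prop :=
  A y /\ forall z, A z -> (z <= y)%O -> z = y.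

Definition covers (y x : S) : Prop :=
  minimal_element [set t | (x < t)%O] y.

Definition lower_covers (x : S) : set S := [set w | covers x w].

End Poset.

Section MarkovChain.
Context {R : realType} {d : measure_display} {T : measurableType d}.
Context {S : choiceType}.
Implicit Types (P : probability T R) (Q : S -> S -> R) (Y : nat -> T -> S).

Definition transition_function Q : Prop :=
  (forall x y, 0 <= Q x y) /\
  (forall x, (\esum_(y in [set: S]) (Q x y)%:E = 1)%E).

(* Real-valued; a junk value when [P B = 0]. *)
Definition cond_prob P (A B : set T) : R := fine (P (A `&` B)) / fine (P B).

(* The initial distribution is arbitrary.  Every subset of the countable state
   space is an event of it. *)
Definition markov_chain P Q Y : Prop :=
  [/\ transition_function Q,
      forall n (A : set S), measurable (Y n @^-1` A) &
      forall n (x : nat -> S),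
        let past := [set w | forall i, (i <= n)%N -> Y i w = x i] in
        P past != 0%E ->
        cond_prob P [set w | Y n.+1 w = x n.+1] past = Q (x n) (x n.+1)].

(* Takes values in {1, 2, ...} or +oo; the infimum of the empty set is +oo. *)
Definition hitting_time Y (x : S) (w : T) : \bar R :=
  ereal_inf [set n%:R%:E | n in [set n : nat | (1 <= n)%N /\ Y n w = x]].

End MarkovChain.

Section DownwardRunChain.
Context {R : realType} {d : measure_display} {T : measurableType d}.
Context {disp : Order.disp_t} {S : bPOrderType disp}.
Implicit Types (P : probability T R) (Q : S -> S -> R) (Y : nat -> T -> S).

Definition downward_run_chain P Q Y : Prop :=
  markov_chain P Q Y /\
  forall x y : S,
    0 < Q x y <-> x = \bot%O \/ (x <> \bot%O /\ lower_covers x y).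

Definition prob_bot P Y (A : set T) : R :=
  cond_prob P A [set w | Y 0%N w = \bot%O].

Definition return_prob P Y (x : S) : R :=
  prob_bot P Y
    [set w | (hitting_time (R := R) Y x w <= hitting_time Y \bot%O w)%E].

End DownwardRunChain.

(* Main.v *)
Require Import Defs.
From HB Require Import structures.
From mathcomp Require Import all_boot all_order all_algebra.
From mathcomp Require Import all_classical all_reals all_analysis.

Import Order.TTheory GRing.Theory Num.Theory.

Local Open Scope classical_set_scope.
Local Open Scope ring_scope.

(** Cut the chain started at the minimum [\bot] into excursions: an excursion
    runs from time [0] to the first return to [\bot].  Away from [\bot] every
    step goes strictly down in the order, and a strictly decreasing infinite
    sequence would be an infinite chain below its first term; hence almost
    surely the excursion ends ([steps_down_return]) and never repeats a state
    other than [\bot].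

    The event [U_x <= U_e] therefore says that the excursion visits [x].  As it
    does so at most once, the probability of this event is an expected number
    of visits, counting [\bot] once; there are two ways to count.  Times
    [0, ..., U_e - 1] include the initial state [\bot] and leave out the final
    one ([visited_excursion_start]); times [1, ..., U_e] do the opposite
    ([visited_excursion_end]).  The two counts agree because an excursion begins
    and ends at the same state.

    Invariance compares the two counts.  By the Markov property
    ([past_event_markov]) the quantity [G x * Q x y] is the expected number of
    steps from [x] to [y] during the excursion, with [G x] in the first count.
    Summing over [x] counts all the steps into [y] during the excursion, that
    is, the visits to [y] in the second count ([visited_invariant]).

    The Markov property is given for one fixed past at a time; it extends to any
    event determined by the past because there are only countably many finite
    trajectories ([measure_fibers]). *)

(** * Sums of nonnegative families *)

Lemma esumZl (R : realType) (I : choiceType) (D : set I) (c : R)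
    (a : I -> \bar R) :
  0 <= c -> (forall i, (0 <= a i)%E) ->
  (\esum_(i in D) (c%:E * a i) = c%:E * \esum_(i in D) a i)%E.
Proof.
move=> c0 a0; rewrite /esum -ereal_supZl//; last first.
  by apply/set0P; eexists; exists set0 => //; exact: fsets_set0.
rewrite image_comp; congr ereal_sup; apply: eq_imagel => X _.
by rewrite [RHS]/= ge0_mule_fsumr.
Qed.

Lemma exchange_esum (R : realType) (I J : choiceType) (a : I -> J -> \bar R) :
  (forall i j, (0 <= a i j)%E) ->
  (\esum_(i in [set: I]) \esum_(j in [set: J]) a i j =
   \esum_(j in [set: J]) \esum_(i in [set: I]) a i j)%E.
Proof.
move=> a0; rewrite !esum_esum//.
rewrite (reindex_esum ([set: J] `*`` fun=> [set: I]) _ (fun x => (x.2, x.1)))//.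
split=> //=.
- by move=> [j1 i1] [j2 i2] /= _ _ [] -> ->.
- by move=> [i j] _; exists (j, i).
Qed.

(** * Probabilities of events up to a null set and along a countable partition *)

Section Measure.
Context {R : realType} {d : measure_display} {T : measurableType d}.
Variable P : probability T R.

Lemma measure_setD_null (A N : set T) : measurable A -> measurable N ->
  P N = 0%E -> P (A `\` N) = P A.
Proof.
move=> mA mN N0; rewrite [RHS](measureDI P mA mN).
rewrite [X in (_ + X)%E](_ : _ = 0%E) ?adde0//.
by apply: (@subset_measure0 _ _ _ P _ N) => //; exact: measurableI.
Qed.

(** Both counts of visits in an excursion are instances: outside a null set,
    visiting [x] is the disjoint union over [n] of visiting [x] at time [n]. *)
Lemma measure_ae_bigcup {V N : set T} {F : nat -> set T} :
    measurable V -> P.-negligible N -> (forall n, measurable (F n)) ->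
    (forall w, ~ N w -> (V w <-> exists n, F n w)) ->
    (forall w n m, ~ N w -> (n < m)%N -> F n w -> ~ F m w) ->
  P V = (\esum_(n in [set: nat]) P (F n))%E.
Proof.
move=> mV [B [mB B0 NB]] mF NVF Ndisj.
have VF w : ~ B w -> V w <-> exists n, F n w.
  by move=> Bw; apply: NVF => /NB.
have disj w n m : ~ B w -> (n < m)%N -> F n w -> ~ F m w.
  by move=> Bw; apply: Ndisj => /NB.
rewrite -(measure_setD_null _ _ mV mB B0).
have -> : V `\` B = \bigcup_n (F n `\` B).
  apply/seteqP; split=> [w [/[swap] Bw /(VF w Bw)[n Fn]]|w [n _ [Fn Bw]]].
    by exists n.
  by split=> //; apply/(VF w Bw); exists n.
rewrite measure_bigcup//.
- rewrite nneseries_esum// set_mem_set.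
  by apply: eq_esum => n _; exact: measure_setD_null.
- by move=> n _; exact: measurableD.
- move=> n m _ _ [w [[Fn Bw] [Fm _]]].
  case: (ltngtP n m) => // nm; exfalso.
  + exact: (disj w n m).
  + exact: (disj w m n).
Qed.

Lemma measure_fibers {K : choiceType} (X : T -> K) (A : set T) :
    countable [set: K] -> (forall k, measurable (A `&` X @^-1` [set k])) ->
  P A = (\esum_(k in [set: K]) P (A `&` X @^-1` [set k]))%E.
Proof.
move=> /countable_injP[f injf] mX.
have {}injf : injective f by move=> k l; apply: injf; rewrite inE.
pose F n := A `&` [set w | f (X w) = n].
have FE k : F (f k) = A `&` X @^-1` [set k].
  by apply/seteqP; split=> w [Aw Xw]; split=> //; [exact: injf|exact: congr1].
have mF n : measurable (F n).
  have [[k <-]|nf] := pselect (exists k, f k = n); first by rewrite FE.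
  rewrite (_ : F n = set0) //; apply/seteqP; split=> w // [_ Fw].
  by apply: nf; exists (X w).
under eq_esum do rewrite -FE.
rewrite -(esum_image _ f (fun n => P (F n))); last by move=> ? ? _ _; exact: injf.
transitivity (\esum_(n in [set: nat]) P (F n))%E.
  apply: (measure_ae_bigcup (N := set0)) => //.
  + rewrite (_ : A = \bigcup_n F n); first exact: bigcupT_measurable.
    by apply/seteqP; split=> [w Aw|w [n _ []]//]; exists (f (X w)).
  + exact: negligible_set0.
  + by move=> w _; split=> [Aw|[n []]//]; exists (f (X w)).
  + by move=> w n m _ + [_ Xn] [_ Xm]; rewrite -Xn -Xm ltnn.
rewrite [RHS]esum_mkcond; apply: eq_esum => n _.
case: ifPn => //; rewrite notin_setE => nf.
rewrite (_ : F n = set0) ?measure0//; apply/seteqP; split=> w // [_ Fw].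
by apply: nf; exists (X w).
Qed.

Lemma negligible_countable_bigcup {K : Type} (F : K -> set T) :
  countable [set: K] -> (forall k, P.-negligible (F k)) ->
  P.-negligible (\bigcup_k F k).
Proof.
move=> /countable_injP[f injf] nullF.
have -> : \bigcup_k F k = \bigcup_n \bigcup_(k in [set k | f k = n]) F k.
  by apply/seteqP; split=> [w [k _ Fk]|w [n _ [k _ Fk]]];
    [exists (f k) => //; exists k|exists k].
apply: negligible_bigcup => n.
have [[k fk]|nf] := pselect (exists k, f k = n).
  apply: negligibleS (nullF k) => w [l /= fl Fl].
  by rewrite (injf k l) ?inE ?fl.
apply: negligibleS (negligible_set0 P) => w [k /= fk _].
by apply: nf; exists k.
Qed.

End Measure.

(** * The Markov property for events of the past *)

Lemma countable_seq (K : choiceType) :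
  countable [set: K] -> countable [set: seq K].
Proof.
move=> /countable_injP[f injf]; apply/countable_injP.
exists (fun s => choice.pickle [seq f x | x <- s]) => s t _ _.
move/(pcan_inj choice.pickleK); apply: inj_map => x y.
by apply: injf; rewrite inE.
Qed.

Definition trajectory {T S : Type} (Y : nat -> T -> S) (n : nat) (w : T) :
  seq S := [seq Y i w | i <- iota 0 n.+1].

Lemma trajectoryP {T S : Type} (Y : nat -> T -> S) (n : nat) (w w' : T) :
  trajectory Y n w = trajectory Y n w' <->
  forall i, (i <= n)%N -> Y i w = Y i w'.
Proof.
have memE i : (i \in iota 0 n.+1) = (i <= n)%N by rewrite mem_iota.
by split=> [/eq_in_map eqY i|eqY]; [rewrite -memE; exact: eqY|
  apply/eq_in_map => i; rewrite memE; exact: eqY].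
Qed.

(** Invariance under equality of trajectories expresses membership of [A] in the
    sigma-algebra generated by [Y 0, ..., Y n]: with countably many states,
    measurability of [A] follows from it. *)
Definition past_event {T S : Type} (Y : nat -> T -> S) (n : nat) (A : set T) :=
  forall w w', (forall i, (i <= n)%N -> Y i w = Y i w') -> A w -> A w'.

Section PastEvents.
Context {R : realType} {d : measure_display} {T : measurableType d}.
Context {S : choiceType}.
Context {P : probability T R} {Q : S -> S -> R} {Y : nat -> T -> S}.
Hypothesis S_countable : countable [set: S].
Hypothesis Y_markov : markov_chain P Q Y.

Lemma measurable_state n (A : set S) : measurable (Y n @^-1` A).
Proof. by case: Y_markov. Qed.

Lemma measurable_cylinder n (x : nat -> S) :
  measurable [set w | forall i, (i <= n)%N -> Y i w = x i].
Proof.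
rewrite (_ : [set w | _] = \bigcap_(i in [set i | (i <= n)%N]) Y i @^-1` [set x i]).
  by apply: bigcap_measurableType => i _; exact: measurable_state.
by apply/seteqP; split.
Qed.

(** Fixing the trajectory decides a past event, so the fibers of [A] are empty or
    are exactly the pasts on which the definition of a Markov chain conditions. *)
Lemma past_event_fiber n {A} s : past_event Y n A ->
  A `&` trajectory Y n @^-1` [set s] = set0 \/
  exists2 w0, A w0 &
    A `&` trajectory Y n @^-1` [set s] =
    [set w | forall i, (i <= n)%N -> Y i w = Y i w0].
Proof.
move=> pastA.
have [[w0 [Aw0 /= sw0]]|/set0P/negP] :=
  pselect (A `&` trajectory Y n @^-1` [set s] !=set0); last first.
  by rewrite negbK => /eqP; left.
right; exists w0 => //; apply/seteqP; split=> [w [_ /=]|w /= eqY].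
  by rewrite -sw0 => /trajectoryP.
split; first by apply: (pastA w0) => // i /eqY.
by rewrite /= -sw0; apply/trajectoryP.
Qed.

Lemma measurable_past_event_fiber {n A} s : past_event Y n A ->
  measurable (A `&` trajectory Y n @^-1` [set s]).
Proof.
move=> pastA; have [->//|[w0 _ ->]] := past_event_fiber n s pastA.
exact: measurable_cylinder.
Qed.

Lemma measurable_past_event {n A} : past_event Y n A -> measurable A.
Proof.
move=> pastA.
rewrite (_ : A = \bigcup_s (A `&` trajectory Y n @^-1` [set s])).
  apply: countable_bigcupT_measurable; first exact: countable_seq.
  by move=> s; exact: measurable_past_event_fiber.
by apply/seteqP; split=> [w Aw|w [s _ []]//]; exists (trajectory Y n w).
Qed.

Lemma cond_probE {A B : set T} : measurable A -> measurable B -> P B != 0%E ->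
  P (A `&` B) = (P B * (cond_prob P A B)%:E)%E.
Proof.
move=> mA mB PB0.
have finB : P B \is a fin_num by exact: fin_num_measure.
have finAB : P (A `&` B) \is a fin_num.
  by apply: fin_num_measure; exact: measurableI.
rewrite -{1}(fineK finB) -EFinM /cond_prob mulrC divfK ?fineK//.
by apply: contra_neq PB0 => B0; rewrite -(fineK finB) B0.
Qed.

(** Sum the defining property of a Markov chain over the possible trajectories
    up to time [n]; those of probability zero contribute zero to both sides. *)
Lemma past_event_markov {n A} x y : past_event Y n A ->
  (forall w, A w -> Y n w = x) ->
  P (A `&` Y n.+1 @^-1` [set y]) = (P A * (Q x y)%:E)%E.
Proof.
move=> pastA Ax.
have Q0 : 0 <= Q x y by case: Y_markov => -[].
have mA := measurable_past_event pastA.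
have mY := measurable_state n.+1 [set y].
have fiberC s : A `&` Y n.+1 @^-1` [set y] `&` trajectory Y n @^-1` [set s] =
    Y n.+1 @^-1` [set y] `&` (A `&` trajectory Y n @^-1` [set s]).
  by rewrite setIAC setIC.
rewrite (measure_fibers P (trajectory Y n) A (countable_seq _ S_countable)); last first.
  by move=> s; exact: measurable_past_event_fiber.
rewrite (measure_fibers P (trajectory Y n) _ (countable_seq _ S_countable)); last first.
  move=> s; rewrite fiberC; apply: measurableI => //.
  exact: measurable_past_event_fiber.
rewrite muleC -esumZl//; apply: eq_esum => s _; rewrite fiberC muleC.
have [->|[w0 Aw0 ->]] := past_event_fiber n s pastA.
  by rewrite setI0 measure0 mul0e.
have mC := measurable_cylinder n (Y^~ w0).
have [PC0|PC0] := eqVneq (P [set w | forall i, (i <= n)%N -> Y i w = Y i w0]) 0%E.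
  rewrite PC0 mul0e; apply: subset_measure0 PC0 => //.
  exact: measurableI.
rewrite cond_probE//; congr (_ * _%:E)%E.
(* The definition takes the past and the next state from a single sequence. *)
pose z i := if (i <= n)%N then Y i w0 else y.
have zC : [set w | forall i, (i <= n)%N -> Y i w = Y i w0] =
    [set w | forall i, (i <= n)%N -> Y i w = z i].
  by apply/seteqP; split=> w eqY i le_in; move: (eqY i le_in); rewrite /z le_in.
case: Y_markov => _ _ /(_ n z) /=; rewrite -zC => /(_ PC0).
by rewrite /z leqnn ltnn Ax.
Qed.

End PastEvents.

(** * Excursions of a single trajectory *)

Section Excursion.
Context {disp : Order.disp_t} {S : bPOrderType disp}.
Implicit Types y : nat -> S.

Definition steps_down y := forall n, y n <> \bot%O -> (y n.+1 < y n)%O.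

(** The return to [\bot] has not occurred by time [n]: step [n] to [n.+1] is
    then part of the excursion, and may be the one that ends it. *)
Definition excursion y n :=
  y 0%N = \bot%O /\ forall i, (0 < i <= n)%N -> y i <> \bot%O.

Lemma steps_down_lt {y m n} : steps_down y -> (m < n)%N ->
  (forall i, (m <= i < n)%N -> y i <> \bot%O) -> (y n < y m)%O.
Proof.
move=> down; elim: n => [//|n IHn]; rewrite ltnS leq_eqVlt.
move=> /predU1P[<-|lt_mn] nbot; first by apply/down/nbot; rewrite leqnn ltnSn.
apply: (@lt_trans _ _ (y n)).
  by apply/down/nbot; rewrite (ltnW lt_mn) ltnSn.
by apply: IHn => // i /andP[le_mi lt_in]; apply: nbot; rewrite le_mi ltnW.
Qed.

(** Otherwise the states from time [1] on decrease strictly forever, and together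
    with [\bot] they form an infinite chain from [\bot] to [y 1]. *)
Lemma steps_down_return {y} : finite_chains_from_bot (S := S) ->
  steps_down y -> exists2 n, (0 < n)%N & y n = \bot%O.
Proof.
move=> S_chains down; apply: contrapT => noret.
have nbot n : y n.+1 <> \bot%O by move=> yn; apply: noret; exists n.+1.
have lt_y m n : (m < n)%N -> (y n.+1 < y m.+1)%O.
  by move=> lt_mn; apply: steps_down_lt => // -[|i].
have le_y m n : (m <= n)%N -> (y n.+1 <= y m.+1)%O.
  by rewrite leq_eqVlt => /predU1P[->//|/lt_y/ltW].
have inj_y : injective (fun n => y n.+1).
  move=> m n eq_y; case: (ltngtP m n) => // /lt_y; first by rewrite eq_y ltxx.
  by rewrite eq_y ltxx.
pose C := [set \bot%O] `|` range (fun n => y n.+1).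
have /S_chains : chain_from_bot (y 1%N) C.
  split.
  - move=> _ _ [->|[m _ <-]] [->|[n _ <-]]; rewrite ?le0x; [by left..| |].
      by right.
    by case: (leqP m n) => [/le_y|/ltnW/le_y]; [right|left].
  - by left.
  - by right; exists 0%N.
  - by move=> _ [->|[n _ <-]]; rewrite !le0x//=; exact: le_y.
rewrite finite_setU => -[_].
rewrite (eq_finite_set (inj_card_eq _)); first exact: infinite_nat.
by move=> ? ? _ _; exact: inj_y.
Qed.

(** Counting the states from which the steps of the excursion start, no state is
    counted twice: [\bot] occurs at time [0] only, and from time [1] on the
    states decrease strictly. *)
Lemma excursion_start {y x m n} : steps_down y -> (m < n)%N ->
  excursion y n -> y m = x -> y n <> x.
Proof.
move=> down lt_mn [y0 nbot] <-.
case: m => [|m] in lt_mn *; first by rewrite y0; apply: nbot; rewrite lt_mn leqnn.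
suff lt_y : (y n < y m.+1)%O by move=> eq_y; rewrite eq_y ltxx in lt_y.
apply: steps_down_lt => // i /andP[lt_mi /ltnW le_in].
by apply: nbot; rewrite (leq_trans _ lt_mi).
Qed.

(** Counting the states at which the steps of the excursion end, no state is
    counted twice: these states decrease strictly. *)
Lemma excursion_end {y x m n} : steps_down y -> (m < n)%N ->
  excursion y n -> y m.+1 = x -> y n.+1 <> x.
Proof.
move=> down lt_mn [y0 nbot] <-.
suff lt_y : (y n.+1 < y m.+1)%O by move=> eq_y; rewrite eq_y ltxx in lt_y.
apply: steps_down_lt => // i /andP[lt_mi le_in].
by apply: nbot; rewrite (leq_trans _ lt_mi).
Qed.

(** The left-hand side unfolds the comparison of hitting times.  Since the return
    to [\bot] does occur, it is not vacuous, and a visit of [x] no later than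
    the first return is the end of a step of the excursion. *)
Lemma excursion_endP {y} x : finite_chains_from_bot (S := S) ->
    steps_down y ->
  (y 0%N = \bot%O /\ forall n, (0 < n)%N -> y n = \bot%O ->
     exists2 m, (0 < m <= n)%N & y m = x) <->
  exists n, excursion y n /\ y n.+1 = x.
Proof.
move=> S_chains down; split=> [[y0 visit]|[n [[y0 nbot] yn]]]; last first.
  split=> // k k_gt0 yk; exists n.+1 => //=; rewrite ltnNge.
  by apply/negP => le_kn; apply: (nbot k) => //; rewrite k_gt0.
have [k0 k0_gt0 /eqP yk0] := steps_down_return S_chains down.
have ex_k : exists k, (0 < k)%N && (y k == \bot%O).
  by exists k0; rewrite k0_gt0.
case: (ex_minnP ex_k) => k /andP[k_gt0 /eqP yk] min_k.
have [[//|m] lt_mk ym] := visit k k_gt0 yk.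
exists m; split=> //; split=> // i /andP[i_gt0 le_im] /eqP yi.
have := min_k i; rewrite i_gt0 yi => /(_ isT).
by rewrite leqNgt (leq_ltn_trans le_im lt_mk).
Qed.

(** For [x] other than [\bot], a step of the excursion ending at [x] is followed
    by one starting there, and conversely.  For [x] equal to [\bot] both sides
    say only that [y] starts at [\bot]. *)
Lemma excursion_startP {y} x : finite_chains_from_bot (S := S) ->
    steps_down y ->
  (y 0%N = \bot%O /\ forall n, (0 < n)%N -> y n = \bot%O ->
     exists2 m, (0 < m <= n)%N & y m = x) <->
  exists n, excursion y n /\ y n = x.
Proof.
move=> S_chains down; split=> [/[dup] [[y0 _]]|].
  have [->|/eqP x_bot] := eqVneq x \bot%O.
    by move=> _; exists 0%N; split=> //; split=> // -[|i].
  move=> /(excursion_endP x S_chains down)[n [[_ nbot] yn]].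
  exists n.+1; split=> //; split=> // i /andP[i_gt0].
  rewrite leq_eqVlt => /predU1P[->|le_in]; first by rewrite yn.
  by apply: nbot; rewrite i_gt0.
have [->|/eqP x_bot] := eqVneq x \bot%O.
  move=> [n [[y0 _] _]]; split=> // k k_gt0 yk.
  by exists k => //; rewrite k_gt0 leqnn.
move=> [[|n] [[y0 nbot] yn]]; first by case: x_bot; rewrite -yn.
apply/(excursion_endP x S_chains down); exists n; split=> //; split=> // i.
by move=> /andP[i_gt0 le_in]; apply: nbot; rewrite i_gt0 ltnW.
Qed.

End Excursion.

(** * The downward run chain *)

Section DownwardRun.
Context {R : realType} {d : measure_display} {T : measurableType d}.
Context {disp : Order.disp_t} {S : bPOrderType disp}.
Context {P : probability T R} {Q : S -> S -> R} {Y : nat -> T -> S}.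

(** When [z] is never hit both sides hold, the right-hand one vacuously. *)
Lemma hitting_time_leP x z w :
  (hitting_time (R := R) Y x w <= hitting_time Y z w)%E <->
  forall n, (0 < n)%N -> Y n w = z -> exists2 m, (0 < m <= n)%N & Y m w = x.
Proof.
split=> [le_xz n n_gt0 Yn|visit].
  have : (hitting_time (R := R) Y x w < n.+1%:R%:E)%E.
    apply: (le_lt_trans le_xz); apply: (@le_lt_trans _ _ n%:R%:E).
      by apply: ereal_inf_lbound; exists n.
    by rewrite lte_fin ltr_nat.
  move=> /ereal_inf_lt[_ [m [m_gt0 Ym] <-]].
  by rewrite lte_fin ltr_nat ltnS => le_mn; exists m; rewrite ?m_gt0.
apply: le_ereal_inf_tmp => _ [n [n_gt0 Yn] <-].
have [m /andP[m_gt0 le_mn] Ym] := visit n n_gt0 Yn.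
apply: (@le_trans _ _ m%:R%:E); last by rewrite lee_fin ler_nat.
by apply: ereal_inf_lbound; exists m.
Qed.

Hypothesis S_countable : countable [set: S].
Hypothesis Y_chain : downward_run_chain P Q Y.

Let Y_markov : markov_chain P Q Y.
Proof. by case: Y_chain. Qed.

Let Q_ge0 x y : 0 <= Q x y.
Proof. by case: Y_markov => -[]. Qed.

Definition start_bot : set T := [set w | Y 0%N w = \bot%O].

Definition visited (x : S) : set T :=
  [set w | (hitting_time (R := R) Y x w <= hitting_time Y \bot%O w)%E] `&`
  start_bot.

Definition during_excursion n : set T := [set w | excursion (Y^~ w) n].

Definition forbidden_step : set T := [set w | ~ steps_down (Y^~ w)].

Lemma during_excursion_past n : past_event Y n (during_excursion n).
Proof.
move=> w w' eqY [Y0 nbot]; split=> [|i /andP[i_gt0 le_in]].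
  by rewrite -eqY.
by rewrite -eqY//; apply: nbot; rewrite i_gt0.
Qed.

Lemma during_excursion_state_past n x :
  past_event Y n (during_excursion n `&` Y n @^-1` [set x]).
Proof.
move=> w w' eqY [ex Yn]; split; first exact: (during_excursion_past n w).
by rewrite /= -eqY.
Qed.

Lemma measurable_start_bot : measurable start_bot.
Proof. exact: (measurable_state Y_markov 0 [set \bot%O]). Qed.

Lemma measurable_visited x : measurable (visited x).
Proof.
apply: measurableI; last exact: measurable_start_bot.
rewrite (_ : [set w | _] = \bigcap_(n in [set n | (0 < n)%N])
    (Y n @^-1` [set~ \bot%O] `|`
     \bigcup_(m in [set m | (0 < m <= n)%N]) Y m @^-1` [set x])).
  apply: bigcap_measurableType => n _; apply: measurableU.
    exact: (measurable_state Y_markov).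
  by apply: bigcup_measurable => m _; exact: (measurable_state Y_markov).
apply/seteqP; split=> [w /hitting_time_leP visit n n_gt0|w visit].
  have [Yn|] := pselect (Y n w = \bot%O); last by left.
  by right; have [m le_mn Ym] := visit n n_gt0 Yn; exists m.
apply/hitting_time_leP => n n_gt0 Yn.
by have [//|[m le_mn Ym]] := visit n n_gt0; exists m.
Qed.

Lemma step_markov n x y :
  P (Y n @^-1` [set x] `&` Y n.+1 @^-1` [set y]) =
  (P (Y n @^-1` [set x]) * (Q x y)%:E)%E.
Proof.
apply: past_event_markov => //.
by move=> w w' eqY; rewrite /= eqY.
Qed.

Lemma transition_down {x y} : x <> \bot%O -> 0 < Q x y -> (y < x)%O.
Proof. by case: Y_chain => _ QP x_bot /QP[//|[_ []]]. Qed.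

(** A step that does not go down has transition probability zero, and there are
    countably many times and pairs of states at which it could occur. *)
Lemma forbidden_step_negligible : P.-negligible forbidden_step.
Proof.
pose step n x y := Y n @^-1` [set x] `&` Y n.+1 @^-1` [set y].
have null_step n x y : Q x y = 0 -> P.-negligible (step n x y).
  move=> Qxy; apply/negligibleP.
    by apply: measurableI; exact: (measurable_state Y_markov).
  by apply: etrans (step_markov n x y) _; rewrite Qxy mule0.
apply: (@negligibleS _ _ _ _ (\bigcup_n \bigcup_x \bigcup_y
    (if Q x y == 0 then step n x y else set0))).
  move=> w /existsNP[n /not_implyP[nbot nlt]].
  exists n => //; exists (Y n w) => //; exists (Y n.+1 w) => //.
  case: ifPn => // Q_neq0; case: nlt; apply: transition_down => //.
  by rewrite lt0r Q_neq0 Q_ge0.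
apply: negligible_bigcup => n.
apply: negligible_countable_bigcup => // x.
apply: negligible_countable_bigcup => // y.
by case: eqP => [/null_step//|_]; exact: negligible_set0.
Qed.

Hypothesis S_chains : finite_chains_from_bot (S := S).

Lemma visitedE w x : visited x w <->
  (Y 0%N w = \bot%O /\ forall n, (0 < n)%N -> Y n w = \bot%O ->
     exists2 m, (0 < m <= n)%N & Y m w = x).
Proof.
by split=> [[/hitting_time_leP visit Y0]|[Y0 visit]]; split=> //;
  exact/hitting_time_leP.
Qed.

Lemma measurable_excursion_state n m x :
  measurable (during_excursion n `&` Y m @^-1` [set x]).
Proof.
apply: measurableI; last exact: (measurable_state Y_markov).
exact: (measurable_past_event S_countable Y_markov (during_excursion_past n)).
Qed.

Lemma visited_excursion_start x : P (visited x) =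
  (\esum_(n in [set: nat]) P (during_excursion n `&` Y n @^-1` [set x]))%E.
Proof.
apply: (measure_ae_bigcup _ (measurable_visited x) forbidden_step_negligible).
- by move=> n; exact: measurable_excursion_state.
- move=> w /contrapT down; rewrite visitedE.
  exact: (excursion_startP x S_chains down).
- move=> w n m /contrapT down lt_nm [_ Yn] [ex_m].
  exact: (excursion_start down lt_nm ex_m Yn).
Qed.

Lemma visited_excursion_end y : P (visited y) =
  (\esum_(n in [set: nat]) P (during_excursion n `&` Y n.+1 @^-1` [set y]))%E.
Proof.
apply: (measure_ae_bigcup _ (measurable_visited y) forbidden_step_negligible).
- by move=> n; exact: measurable_excursion_state.
- move=> w /contrapT down; rewrite visitedE.
  exact: (excursion_endP y S_chains down).
- move=> w n m /contrapT down lt_nm [_ Yn] [ex_m].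
  exact: (excursion_end down lt_nm ex_m Yn).
Qed.

(** The steps from [x] to [y] within the excursion, summed over [x]: weighting the
    starts of steps at [x] by [Q x y] counts them, and so do the ends of steps
    at [y], split according to the preceding state. *)
Lemma visited_invariant y :
  (\esum_(x in [set: S]) (P (visited x) * (Q x y)%:E) = P (visited y))%E.
Proof.
rewrite visited_excursion_end.
have -> : (\esum_(x in [set: S]) (P (visited x) * (Q x y)%:E) =
    \esum_(x in [set: S]) \esum_(n in [set: nat])
      P (during_excursion n `&` Y n @^-1` [set x] `&` Y n.+1 @^-1` [set y]))%E.
  apply: eq_esum => x _; rewrite visited_excursion_start muleC -esumZl//.
  apply: eq_esum => n _; rewrite muleC.
  rewrite (past_event_markov S_countable Y_markov x y
    (during_excursion_state_past n x))//.
  by move=> w [].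
rewrite exchange_esum//; apply: eq_esum => n _.
rewrite (measure_fibers P (Y n) _ S_countable).
  by apply: eq_esum => x _; rewrite setIAC.
move=> x; apply: measurableI; last exact: (measurable_state Y_markov).
exact: measurable_excursion_state.
Qed.

(** The chain can jump from [\bot] to [x] in one step, which no return to [\bot]
    precedes. *)
Lemma visited_gt0 x : (0 < P start_bot)%E -> (0 < P (visited x))%E.
Proof.
move=> start_gt0.
apply: (@lt_le_trans _ _ (P (start_bot `&` Y 1%N @^-1` [set x]))).
  rewrite [X in (_ < X)%E](step_markov 0).
  apply: mule_gt0 => //; rewrite lte_fin.
  by case: Y_chain => _ QP; apply/QP; left.
apply: le_measure; rewrite ?inE; [|exact: measurable_visited|].
  by apply: measurableI; [exact: measurable_start_bot|
    exact: (measurable_state Y_markov)].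
move=> w [Y0 Y1]; apply/visitedE; split=> // n n_gt0 _.
by exists 1%N => //; rewrite n_gt0.
Qed.

Lemma return_probE x :
  return_prob P Y x = fine (P (visited x)) / fine (P start_bot).
Proof. by []. Qed.

End DownwardRun.

Theorem proposition3 (R : realType) (disp : Order.disp_t)
    (S : bPOrderType disp) (d : measure_display) (T : measurableType d)
    (P : probability T R) (Q : S -> S -> R) (Y : nat -> T -> S)
    (S_countable : countable [set: S])
    (S_chains : @finite_chains_from_bot disp S)
    (Y_chain : downward_run_chain P Q Y)
    (Y0_bot : (0 < P [set w | Y 0%N w = \bot%O])%E) :
  let G := return_prob P Y in
  (forall x : S, 0 < G x <= 1) /\
  (forall y : S, (\esum_(x in [set: S]) (G x * Q x y)%:E = (G y)%:E)%E).
Proof.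
move=> G; have [[[Q_ge0 _] _ _] _] := Y_chain.
have mstart := measurable_start_bot Y_chain.
have mvisited x := measurable_visited Y_chain x.
have fin_visited x : P (visited (R := R) (Y := Y) x) \is a fin_num.
  exact: fin_num_measure.
pose p := fine (P (start_bot (Y := Y))).
have p_gt0 : 0 < p.
  by apply: fine_gt0; rewrite Y0_bot ltey_eq fin_num_measure.
have GE x : (G x)%:E = (p^-1%:E * P (visited (R := R) (Y := Y) x))%E.
  by rewrite /G return_probE mulrC EFinM fineK.
split=> [x|y].
  apply/andP; split.
    rewrite -lte_fin GE mule_gt0 ?lte_fin ?invr_gt0//.
    exact: (visited_gt0 S_countable Y_chain).
  rewrite /G return_probE ler_pdivrMr// mul1r.
  apply: fine_le => //; first exact: fin_num_measure.
  by apply: le_measure; rewrite ?inE// => w [].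
under eq_esum do rewrite EFinM GE -muleA.
rewrite esumZl ?invr_ge0 ?ltW//; last first.
  by move=> x; rewrite mule_ge0// lee_fin.
by rewrite (visited_invariant S_countable Y_chain S_chains) GE.
Qed.
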